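(* Let $\varepsilon\in\{1,-1\}$, $\nu,\beta\in\mathbb{N}_0$, $\alpha\in\mathbb{N}$. For $k\in\mathbb{N}_0$ and $N\in\mathbb{N}$ let $S_k(N;x)=\sum_{n=0}^{N-1}\varepsilon^n\,(n+\nu)!\,(n+\nu)^k\,x^{\alpha n+\beta}$; these sums satisfy the recurrence relation $$S_k(N;x)=\nu!\,\nu^k x^\beta+\varepsilon x^\alpha S_0(N;x)+\varepsilon x^\alpha\sum_{\ell=1}^{k+1}\binom{k+1}{\ell}S_\ell(N;x)-\varepsilon^N (N+\nu)!\,(N+\nu)^k x^{\alpha N+\beta}.$$ This recurrence relation has its solution in the following form: for all $k\in\mathbb{N}$ and $N\in\mathbb{N}$, $$\sum_{n=0}^{N-1}\varepsilon^n\,(n+\nu)!\,\big[(n+\nu)^k x^{k\alpha}+U_{k\alpha}(x)\big]\,x^{\alpha n+\beta}=V_{(k-1)\alpha}(x)+A_{(k-1)\alpha}(N;x)\,\varepsilon^{N-1}(N+\nu)!\,x^{\alpha N+\beta},$$ where the polynomials $U_{k\alpha}(x)$, $V_{(k-1)\alpha}(x)$ and $A_{(k-1)\alpha}(N;x)$ $(k\in\mathbb{N})$ are those given by the following recurrence relations and initial values, with $k=1,2,\dots$: $$\sum_{\ell=1}^{k+1}\binom{k+1}{\ell}x^{(k-\ell+1)\alpha}U_{\ell\alpha}(x)-\varepsilon U_{k\alpha}(x)-x^{(k+1)\alpha}=0,\qquad U_{1\alpha}(x)=x^\alpha-\varepsilon,$$ $$\sum_{\ell=1}^{k+1}\binom{k+1}{\ell}x^{(k-\ell+1)\alpha}V_{(\ell-1)\alpha}(x)-\varepsilon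 V_{(k-1)\alpha}(x)+\varepsilon\,\nu!\,\nu^k x^{k\alpha+\beta}=0,\qquad V_0(x)=-\varepsilon\,\nu!\,x^\beta,$$ $$\sum_{\ell=1}^{k+1}\binom{k+1}{\ell}x^{(k-\ell+1)\alpha}A_{(\ell-1)\alpha}(N;x)-\varepsilon A_{(k-1)\alpha}(N;x)-(N+\nu)^k x^{k\alpha}=0,\qquad A_0(N;x)=1.$$
   Context: $\mathbb{N}=\{1,2,\dots\}$ and $\mathbb{N}_0=\mathbb{N}\cup\{0\}$. The parameters $\varepsilon,\nu,\alpha,\beta$ are fixed. The identities are identities of polynomials in $x$, so they are valid for $x\in\mathbb{R}$ and for $x\in\mathbb{Q}_p$ for every prime $p$. In each of the three recurrences the $\ell=k+1$ term has coefficient $1$, so the recurrence together with its initial value determines the sequence of polynomials. The convention $x^0=1$ (including $0^0=1$) is used. *)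

(* Defs.v *)
From mathcomp Require Import all_boot all_order all_algebra.
From mathcomp Require Import ring.

Set Implicit Arguments.
Unset Strict Implicit.
Unset Printing Implicit Defensive.

Import GRing.Theory.
Local Open Scope ring_scope.

(* All polynomials have coefficients in an arbitrary commutative ring [R], so
   that evaluation at real or p-adic [x] is an instance.  The families
   [U], [V] and [A] are indexed, as in the literature, by the multiples
   [l * alpha] of [alpha]; values at other indices are irrelevant. *)

Definition factorial_sum (R : comNzRingType) (eps : R) (nu alpha beta k N : nat)
    : {poly R} :=
  \sum_(0 <= n < N)
    eps%:P ^+ n * (n + nu)`!%:R * (n + nu)%:R ^+ k * 'X^(alpha * n + beta).

Definition U_recurrence (R : comNzRingType) (eps : R) (alpha : nat)
    (U : nat -> {poly R}) : Prop :=
  U (1 * alpha)%N = 'X^alpha - eps%:P /\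
  forall k : nat, (1 <= k)%N ->
    \sum_(1 <= l < k.+2)
       'C(k.+1, l)%:R * 'X^((k.+1 - l) * alpha) * U (l * alpha)%N
    - eps%:P * U (k * alpha)%N - 'X^(k.+1 * alpha) = 0.

Definition V_recurrence (R : comNzRingType) (eps : R) (nu alpha beta : nat)
    (V : nat -> {poly R}) : Prop :=
  V 0%N = - (eps%:P * nu`!%:R * 'X^beta) /\
  forall k : nat, (1 <= k)%N ->
    \sum_(1 <= l < k.+2)
       'C(k.+1, l)%:R * 'X^((k.+1 - l) * alpha) * V ((l - 1) * alpha)%N
    - eps%:P * V ((k - 1) * alpha)%N
    + eps%:P * nu`!%:R * nu%:R ^+ k * 'X^(k * alpha + beta) = 0.

(* For a fixed [N]; [A m] is the polynomial A_m(N; x). *)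
Definition A_recurrence (R : comNzRingType) (eps : R) (nu alpha N : nat)
    (A : nat -> {poly R}) : Prop :=
  A 0%N = 1 /\
  forall k : nat, (1 <= k)%N ->
    \sum_(1 <= l < k.+2)
       'C(k.+1, l)%:R * 'X^((k.+1 - l) * alpha) * A ((l - 1) * alpha)%N
    - eps%:P * A ((k - 1) * alpha)%N
    - (N + nu)%:R ^+ k * 'X^(k * alpha) = 0.

(* The recurrences are solvable, so hypotheses of this form are not vacuous. *)

Lemma recurrence_solvable (R : comNzRingType) (eps : R) (alpha : nat)
    (w : {poly R}) (c : nat -> {poly R}) :
  exists W : nat -> {poly R}, W 1%N = w /\
    forall k : nat, (1 <= k)%N ->
      \sum_(1 <= l < k.+2)
         'C(k.+1, l)%:R * 'X^((k.+1 - l) * alpha) * W l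
      - eps%:P * W k + c k = 0.
Proof.
pose step k (s : seq {poly R}) :=
  eps%:P * s`_k - c k -
  \sum_(1 <= l < k.+1) 'C(k.+1, l)%:R * 'X^((k.+1 - l) * alpha) * s`_l.
pose L := fix L k := if k is k'.+1 then rcons (L k') (step k'.+1 (L k'))
                     else [:: 0; w].
have sizeL k : size (L k) = k.+2.
  by elim: k => //= k IHk; rewrite size_rcons IHk.
have LS k l : (l <= k.+1)%N -> (L k.+1)`_l = (L k)`_l.
  by move=> lk; rewrite [L k.+1]/= nth_rcons sizeL ltnS lk.
have LE k l : (l <= k.+1)%N -> (L l)`_l = (L k)`_l.
  elim: k l => [|k IHk] l.
    by case: l => [|[|]] // _; rewrite LS.
  rewrite leq_eqVlt => /predU1P[->|lk]; first by rewrite LS.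
  by rewrite IHk // LS.
exists (fun l => (L l)`_l); split=> [|[//|k] _]; first by rewrite LS.
rewrite big_nat_recr //= binn subnn mul0n expr0 !mul1r.
have -> : (rcons (rcons (L k) (step k.+1 (L k)))
            (step k.+2 (rcons (L k) (step k.+1 (L k)))))`_k.+2
          = step k.+1 (L k).
  by rewrite !nth_rcons !size_rcons !sizeL !ltnS leqnn ltnn eqxx.
have -> : (rcons (L k) (step k.+1 (L k)))`_k.+1 = (L k)`_k.+1.
  by rewrite nth_rcons sizeL ltnS leqnn.
rewrite {1}/step (eq_big_nat _ _ (F2 := fun l =>
  'C(k.+2, l)%:R * 'X^((k.+2 - l) * alpha) * (L k)`_l)); last first.
  by move=> l /andP[_ lk]; rewrite (LE k).
ring.
Qed.

Lemma U_recurrence_solvable (R : comNzRingType) (eps : R) (alpha : nat) :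
  (1 <= alpha)%N -> exists U, U_recurrence eps alpha U.
Proof.
move=> a0; have [W [W1 WP]] := recurrence_solvable eps alpha
  ('X^alpha - eps%:P) (fun k => - 'X^(k.+1 * alpha)).
exists (fun m => W (m %/ alpha)%N); split=> [|k k0]; first by rewrite mulnK.
rewrite mulnK // -[RHS](WP k k0); do 2 congr (_ - _).
by apply: eq_bigr => l _; rewrite mulnK.
Qed.

Lemma V_recurrence_solvable (R : comNzRingType) (eps : R)
    (nu alpha beta : nat) :
  (1 <= alpha)%N -> exists V, V_recurrence eps nu alpha beta V.
Proof.
move=> a0; have [W [W1 WP]] := recurrence_solvable eps alpha
  (- (eps%:P * nu`!%:R * 'X^beta))
  (fun k => eps%:P * nu`!%:R * nu%:R ^+ k * 'X^(k * alpha + beta)).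
exists (fun m => W (m %/ alpha).+1); split=> [|k k0]; first by rewrite div0n.
rewrite mulnK // subn1 prednK // -[RHS](WP k k0); congr (_ - _ + _).
by apply: eq_big_nat => l /andP[l0 _]; rewrite mulnK // subn1 prednK.
Qed.

Lemma A_recurrence_solvable (R : comNzRingType) (eps : R)
    (nu alpha N : nat) :
  (1 <= alpha)%N -> exists A, A_recurrence eps nu alpha N A.
Proof.
move=> a0; have [W [W1 WP]] := recurrence_solvable eps alpha 1
  (fun k => - ((N + nu)%:R ^+ k * 'X^(k * alpha))).
exists (fun m => W (m %/ alpha).+1); split=> [|k k0]; first by rewrite div0n.
rewrite mulnK // subn1 prednK // -[RHS](WP k k0); do 2 congr (_ - _).
by apply: eq_big_nat => l /andP[l0 _]; rewrite mulnK // subn1 prednK.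
Qed.

(* Main.v *)
Require Import Defs.
From mathcomp Require Import all_boot all_order all_algebra.
From mathcomp Require Import ring.

(** Comparing the sum over [n < N] with its copy shifted by one index gives the
    recurrence for the sums [S k]: the shift multiplies the summand by
    [eps * 'X^alpha], and [(m + 1)! (m + 1)^k = m! (m + 1)^(k + 1)] is expanded
    by the binomial theorem.

    Since [eps ^ 2 = 1], multiplying that recurrence by [eps * 'X^(k * alpha)]
    turns it into one for the weighted sums [T k = 'X^(k * alpha) * S k],
    namely [\sum_(1 <= l <= k + 1) 'C(k + 1, l) 'X^((k + 1 - l) alpha) T l
    = eps * T k + (three source terms)], where the sources are a multiple of
    [S 0], a contribution of the index [n = 0], and one of the index [n = N].
    The recurrences of [U], [V] and [A] have the same linear part, and each of
    them carries one of these sources; so, by linearity, [T k + U k * S 0] and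
    [V (k - 1) + A (k - 1) * (boundary factor)] solve the same inhomogeneous
    recurrence.  The case [k = 0] of the recurrence for [S] makes
    their values at [k = 1] agree.  The term of highest index has coefficient
    [1], so a solution is determined by its value at [1]
    ([binomial_recurrence_unique]), and the two sides coincide. *)

Set Implicit Arguments.
Unset Strict Implicit.
Unset Printing Implicit Defensive.

Import GRing.Theory.
Local Open Scope ring_scope.

(** The leading coefficient ['C(k.+1, k.+1) * x ^+ 0] is [1], so each equation
    can be solved for its term of highest index, in any commutative ring and
    without division. *)
Lemma binomial_recurrence_unique (R : comNzRingType) (x e : R) (c W W' : nat -> R) :
  (forall k, (1 <= k)%N ->
     \sum_(1 <= l < k.+2) 'C(k.+1, l)%:R * x ^+ (k.+1 - l) * W l
     = e * W k + c k) ->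
  (forall k, (1 <= k)%N ->
     \sum_(1 <= l < k.+2) 'C(k.+1, l)%:R * x ^+ (k.+1 - l) * W' l
     = e * W' k + c k) ->
  W 1%N = W' 1%N ->
  forall k, (1 <= k)%N -> W k = W' k.
Proof.
move=> WP W'P W1 k; elim/ltn_ind: k => -[//|[//|k]] IH _.
have := WP k.+1 isT; rewrite (IH k.+1) // -(W'P k.+1) //.
rewrite big_nat_recr //= [RHS]big_nat_recr //= binn subnn expr0 !mul1r.
rewrite (eq_big_nat _ _ (F2 := fun l =>
  'C(k.+2, l)%:R * x ^+ (k.+2 - l) * W' l)); first by move/addrI.
by move=> l /andP[l_gt0 l_lt]; rewrite IH.
Qed.

(** Telescoping: both sides compute the sum over [n <= N], which the left-hand
    side splits at its last term and the right-hand side at its first. *)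
Lemma factorial_sum_shift (R : comNzRingType) (eps : R) (nu alpha beta k N : nat) :
  factorial_sum eps nu alpha beta k N
    + eps%:P ^+ N * (N + nu)`!%:R * (N + nu)%:R ^+ k * 'X^(alpha * N + beta)
  = nu`!%:R * nu%:R ^+ k * 'X^beta
    + eps%:P * 'X^alpha * \sum_(0 <= l < k.+2)
        'C(k.+1, l)%:R * factorial_sum eps nu alpha beta l N.
Proof.
rewrite /factorial_sum -(big_nat_recr N 0%N) //= big_nat_recl //=.
rewrite expr0 mul1r muln0 !add0n; congr (_ + _).
under [X in _ = _ * X]eq_bigr do rewrite mulr_sumr.
rewrite exchange_big /= mulr_sumr; apply: eq_bigr => n _.
have binomial : (n.+1 + nu)%:R ^+ k.+1
    = \sum_(0 <= l < k.+2) 'C(k.+1, l)%:R * (n + nu)%:R ^+ l :> {poly R}.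
  rewrite addSn -add1n natrD exprDn big_mkord; apply: eq_bigr => l _.
  by rewrite expr1n mul1r mulr_natl.
transitivity (eps%:P * 'X^alpha * (eps%:P ^+ n * (n + nu)`!%:R
    * (n.+1 + nu)%:R ^+ k.+1 * 'X^(alpha * n + beta))).
  rewrite addSn factS natrM mulnSr addnAC exprD !exprS; ring.
rewrite binomial mulr_sumr mulr_suml !mulr_sumr.
by apply: eq_bigr => l _; ring.
Qed.

(** The sum that shifting produces starts at [l = 0]; its first term is the
    [S 0] that the recurrence displays separately. *)
Lemma factorial_sum_recurrence (R : comNzRingType) (eps : R)
    (nu alpha beta k N : nat) :
  let S l := factorial_sum eps nu alpha beta l N in
  S k = nu`!%:R * nu%:R ^+ k * 'X^beta
        + eps%:P * 'X^alpha * S 0%N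
        + eps%:P * 'X^alpha * (\sum_(1 <= l < k.+2) 'C(k.+1, l)%:R * S l)
        - eps%:P ^+ N * (N + nu)`!%:R * (N + nu)%:R ^+ k
          * 'X^(alpha * N + beta).
Proof.
move=> S; apply/eqP; rewrite eq_sym subr_eq eq_sym factorial_sum_shift.
by rewrite big_ltn // bin0 mul1r mulrDr addrA.
Qed.

(** The form of the recurrence for [S] in which the linear part is the one of
    [U], [V] and [A]: here [eps ^+ 2 = 1] moves [eps] from the shifted sum to
    the unshifted one. *)
Lemma weighted_factorial_sum_recurrence (R : comNzRingType) (eps : R)
    (nu alpha beta k N : nat) :
  eps * eps = 1 -> (1 <= N)%N ->
  let T l := 'X^(l * alpha) * factorial_sum eps nu alpha beta l N in
  \sum_(1 <= l < k.+2) 'C(k.+1, l)%:R * 'X^((k.+1 - l) * alpha) * T l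
  = eps%:P * T k - 'X^(k.+1 * alpha) * factorial_sum eps nu alpha beta 0 N
    - eps%:P * nu`!%:R * nu%:R ^+ k * 'X^(k * alpha + beta)
    + (N + nu)%:R ^+ k * 'X^(k * alpha)
      * (eps%:P ^+ (N - 1) * (N + nu)`!%:R * 'X^(alpha * N + beta)).
Proof.
move=> eps2 N_gt0 /=.
have epsP2 : eps%:P * eps%:P = 1 :> {poly R} by rewrite -polyCM eps2.
have epsN : eps%:P ^+ N = eps%:P * eps%:P ^+ (N - 1) :> {poly R}.
  by rewrite -exprS subn1 prednK.
transitivity ('X^(k.+1 * alpha) * \sum_(1 <= l < k.+2)
    'C(k.+1, l)%:R * factorial_sum eps nu alpha beta l N).
  rewrite mulr_sumr; apply: eq_big_nat => l /andP[_ l_le].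
  have -> : 'X^(k.+1 * alpha) = 'X^((k.+1 - l) * alpha) * 'X^(l * alpha)
      :> {poly R} by rewrite -exprD -mulnDl subnK.
  by ring.
rewrite [factorial_sum _ _ _ _ k N]factorial_sum_recurrence epsN.
rewrite mulSn !exprD.
move: (\sum_(_ <= _ < _) _) (factorial_sum _ _ _ _ 0 N) => B S0.
ring: epsP2.
Qed.

Theorem theorem3p1 (R : comNzRingType) (eps : R) (nu alpha beta : nat)
    (eps_sign : eps = 1 \/ eps = -1) (alpha_gt0 : (1 <= alpha)%N) :
  (forall k N : nat, (1 <= N)%N ->
     let S l := factorial_sum eps nu alpha beta l N in
     S k = nu`!%:R * nu%:R ^+ k * 'X^beta
           + eps%:P * 'X^alpha * S 0%N
           + eps%:P * 'X^alpha * (\sum_(1 <= l < k.+2) 'C(k.+1, l)%:R * S l)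
           - eps%:P ^+ N * (N + nu)`!%:R * (N + nu)%:R ^+ k
             * 'X^(alpha * N + beta))
  /\
  (forall (U V : nat -> {poly R}) (A : nat -> nat -> {poly R}),
     U_recurrence eps alpha U ->
     V_recurrence eps nu alpha beta V ->
     (forall N : nat, (1 <= N)%N -> A_recurrence eps nu alpha N (A^~ N)) ->
     forall k N : nat, (1 <= k)%N -> (1 <= N)%N ->
       \sum_(0 <= n < N)
          eps%:P ^+ n * (n + nu)`!%:R
          * ((n + nu)%:R ^+ k * 'X^(k * alpha) + U (k * alpha)%N)
          * 'X^(alpha * n + beta)
       = V ((k - 1) * alpha)%N
         + A ((k - 1) * alpha)%N N * eps%:P ^+ (N - 1) * (N + nu)`!%:R
           * 'X^(alpha * N + beta)).
Proof.
split=> [k N _|U V A [U1 UP] [V0 VP] AP k N k_gt0 N_gt0].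
  exact: factorial_sum_recurrence.
have eps2 : eps * eps = 1 by case: eps_sign => ->; rewrite ?mulrNN mulr1.
have [A0 {}AP] := AP N N_gt0.
set E := eps%:P ^+ (N - 1) * (N + nu)`!%:R * 'X^(alpha * N + beta).
pose S0 := factorial_sum eps nu alpha beta 0 N.
pose T l := 'X^(l * alpha) * factorial_sum eps nu alpha beta l N.
have TP := @weighted_factorial_sum_recurrence _ _ nu alpha beta _ N eps2 N_gt0.
transitivity (T k + U (k * alpha)%N * S0).
  rewrite /T /S0 /factorial_sum !mulr_sumr -big_split /=.
  by apply: eq_bigr => n _; ring.
transitivity (V ((k - 1) * alpha)%N + A ((k - 1) * alpha)%N N * E); last first.
  by rewrite /E; ring.
have expX l : 'X^(l * alpha) = 'X^alpha ^+ l :> {poly R}.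
  by rewrite mulnC exprM.
pose c j : {poly R} := (N + nu)%:R ^+ j * 'X^(j * alpha) * E
  - eps%:P * nu`!%:R * nu%:R ^+ j * 'X^(j * alpha + beta).
apply: (@binomial_recurrence_unique _ 'X^alpha eps%:P c
  (fun j => T j + U (j * alpha)%N * S0)
  (fun j => V ((j - 1) * alpha)%N + A ((j - 1) * alpha)%N N * E)) => //.
- move=> j j_gt0.
  under eq_bigr do rewrite -expX mulrDr [_ * (_ * S0)]mulrA.
  rewrite big_split -mulr_suml /= TP -/(T j) -/S0 -/E /c.
  by move/subr0_eq: (UP j j_gt0) => /(canRL (subrK _)) ->; ring.
- move=> j j_gt0.
  under eq_bigr do rewrite -expX mulrDr [_ * (_ * E)]mulrA.
  rewrite big_split -mulr_suml /= /c.
  move/subr0_eq: (AP j j_gt0) => /(canRL (subrK _)) ->.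
  move/(canRL (addrK _)): (VP j j_gt0) => /(canRL (subrK _)) ->; ring.
(* The recurrence of [T] at [k = 0] has [T 1] as its only left-hand term. *)
have := TP 0%N; cbv zeta; rewrite big_nat1 -/(T 1%N) -/(T 0%N) -/S0 -/E.
rewrite binn subnn mul0n !expr0 !mul1r => T1.
rewrite U1 V0 A0 T1 /T -/S0 add0n mul1n mul0n expr0.
ring.
Qed.
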